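(* Let $n\ge1$ and let $m_1,\dots,m_n$ be positive integers, and put $m_0=1$. Let $\Gamma=\mathbf C[m_n,m_{n-1},\dots,m_1,1]$ be the complete layered graph with $|V_i|=m_i$ for $0\le i\le n$. Then $$\frac{1-t}{H(A(\Gamma),t)}=1-\sum_{k=0}^n\sum_{a=k}^n(-1)^k\,m_a(m_{a-1}-1)(m_{a-2}-1)\cdots(m_{a-k+1}-1)m_{a-k}\,t^{k+1},$$ where for $k=1$ the term is $m_am_{a-1}$ (no factors $(m_j-1)$), and for $k=0$ the term is interpreted as $m_a$.
   Context: A layered directed graph $\Gamma=(V,E)$ has $V=\bigcup_{i=0}^nV_i$, $E=\bigcup_{i=1}^nE_i$, and tail/head maps $\mathbf t,\mathbf h:E\to V$ with $\mathbf t(E_i)\subseteq V_i$, $\mathbf h(E_i)\subseteq V_{i-1}$. It is complete if for every $1\le i\le n$ and every $v\in V_i$, $w\in V_{i-1}$ there is a unique edge $e$ with $\mathbf t(e)=v$, $\mathbf h(e)=w$; $\mathbf C[m_n,\dots,m_0]$ denotes the complete layered graph with $|V_i|=m_i$. A path $\pi=(e_1,\dots,e_m)$ is a sequence of edges with $\mathbf h(e_i)=\mathbf t(e_{i+1})$. Fix a field $F$, let $T(E)$ be the free associative $F$-algebra on $E$, put $P_\pi(\tau)=(\tau-e_1)\cdots(\tau-e_m)=\sum_{j=0}^m e(\pi,j)\tau^{m-j}$ ($\tau$ central), and let $R$ be the ideal generated by all $e(\pi_1,k)-e(\pi_2,k)$ for paths $\pi_1,\pi_2$ with common tail and common head and $1\le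 k\le$ length of $\pi_1$. $A(\Gamma)=T(E)/R$, graded with edges in degree $1$, and $H(A,t)=\sum_i\dim A_i\,t^i$. *)

(* Defs.v *)
From HB Require Import structures.
From mathcomp Require Import all_boot all_order all_algebra.
From mathcomp Require Import finmap boolp monalg.

Set Implicit Arguments.
Unset Strict Implicit.
Unset Printing Implicit Defensive.

Import GRing.Theory.

Local Open Scope ring_scope.
Local Open Scope quotient_scope.

(* Since [vert] and [edge] are finite types, only finite graphs are covered.
   The level function encodes the disjoint union V = V_0 + ... + V_n; an edge
   lies in E_i when its tail has level i, and [levelE] forces 1 <= i <= n. *)
Record layered_graph (n : nat) := LayeredGraph {
  vert : finType;
  edge : finType;
  etail : edge -> vert;
  ehead : edge -> vert;
  level : vert -> 'I_n.+1;
  levelE : forall e, level (etail e) = (level (ehead e)).+1 :> nat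
}.

Section LayeredGraph.
Variables (n : nat) (G : layered_graph n).

Definition layer (i : 'I_n.+1) : {set vert G} := [set v | level v == i].

Definition complete_layered : Prop :=
  forall v w : vert G, level v = (level w).+1 :> nat ->
    exists! e : edge G, etail e = v /\ ehead e = w.

(* A path (of positive length) is given by its first edge [e] and the sequence
   [p] of the remaining ones; as an edge sequence it is [e :: p]. *)
Definition is_path (e : edge G) (p : seq (edge G)) : bool :=
  path (fun e1 e2 => ehead e1 == etail e2) e p.
Definition path_tail (e : edge G) (p : seq (edge G)) : vert G := etail e.
Definition path_head (e : edge G) (p : seq (edge G)) : vert G :=
  ehead (last e p).

End LayeredGraph.

(* [G] is C[m n, ..., m 1, m 0]. *)
Definition is_complete_layered_graph (n : nat) (m : nat -> nat)
    (G : layered_graph n) : Prop :=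
  complete_layered G /\ forall i : 'I_n.+1, #|layer G i| = m i.

Section IdealGen.
Variable T : nzRingType.

Definition two_sided_ideal (I : T -> Prop) : Prop :=
  [/\ I 0,
      forall x y, I x -> I y -> I (x - y),
      forall a x, I x -> I (a * x)
    & forall a x, I x -> I (x * a)].

Definition ideal_gen (S : T -> Prop) (x : T) : Prop :=
  forall I : T -> Prop, two_sided_ideal I -> (forall s, S s -> I s) -> I x.

Lemma ideal_genP (S : T -> Prop) : two_sided_ideal (ideal_gen S).
Proof.
split=> [I [] //|x y Ix Iy I II SI|a x Ix I II SI|a x Ix I II SI].
- by have [_ IB _ _] := II; apply: IB; [apply: Ix|apply: Iy].
- by have [_ _ Il _] := II; apply: Il; apply: Ix.
- by have [_ _ _ Ir] := II; apply: Ir; apply: Ix.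
Qed.

End IdealGen.

Notation free_alg F G := {malg F[{fmonom edge G}]}.

Section GraphIdeal.
Variables (F : fieldType) (n : nat) (G : layered_graph n).
Local Notation T := (free_alg F G).

Definition edge_gen (e : edge G) : T := << fmu e >>.

(* In [{poly T}] the indeterminate is central, although [T] is not
   commutative; the product is taken in the order of the path. *)
Definition path_poly (p : seq (edge G)) : {poly T} :=
  \prod_(e <- p) ('X - (edge_gen e)%:P).

Definition path_coef (p : seq (edge G)) (k : nat) : T :=
  (path_poly p)`_(size p - k).

Definition relator (x : T) : Prop :=
  exists e1 p1 e2 p2 k,
    [/\ is_path e1 p1 /\ is_path e2 p2,
        path_tail e1 p1 = path_tail e2 p2,
        path_head e1 p1 = path_head e2 p2,
        (1 <= k <= size (e1 :: p1))%N
      & x = path_coef (e1 :: p1) k - path_coef (e2 :: p2) k].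

Definition graph_ideal : {pred T} := fun x => `[< ideal_gen relator x >].

Lemma graph_idealP x : reflect (ideal_gen relator x) (x \in graph_ideal).
Proof. exact: asboolP. Qed.

Lemma graph_ideal_zmod : zmod_closed graph_ideal.
Proof.
have [I0 IB _ _] := ideal_genP relator.
by split=> [|x y /graph_idealP Ix /graph_idealP Iy]; apply/graph_idealP => //;
  apply: IB.
Qed.

HB.instance Definition _ :=
  GRing.isZmodClosed.Build T graph_ideal graph_ideal_zmod.

Lemma graph_idealMl a x : x \in graph_ideal -> a * x \in graph_ideal.
Proof.
have [_ _ Il _] := ideal_genP relator.
by move=> /graph_idealP Ix; apply/graph_idealP; apply: Il.
Qed.

Lemma graph_idealMr a x : x \in graph_ideal -> x * a \in graph_ideal.
Proof.
have [_ _ _ Ir] := ideal_genP relator.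
by move=> /graph_idealP Ix; apply/graph_idealP; apply: Ir.
Qed.

Lemma graph_idealZ (c : F) x : x \in graph_ideal -> c *: x \in graph_ideal.
Proof. by move=> Ix; rewrite -mul_malgC graph_idealMl. Qed.

Lemma free_scalerAr (c : F) (x y : T) : c *: (x * y) = x * (c *: y).
Proof.
apply/malgP => k; rewrite mcoeffZ.
rewrite (mcoeffMl x y) (mcoeffMlw _ (fsubset_refl _) (msuppZ_le c y)).
rewrite mulr_sumr; apply: eq_bigr => k1 _; rewrite mulr_sumr.
by apply: eq_bigr => k2 _; rewrite mcoeffZ mulrnAr mulrCA.
Qed.

Lemma graph_ideal1 : 1 \notin graph_ideal.
Proof.
pose aug : {rmorphism T -> F} := @mcoeff _ _ (@mone _).
have augB x y : aug (x - y) = aug x - aug y by exact: raddfB.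
have augM x y : aug (x * y) = aug x * aug y by exact: rmorphM.
apply/negP => /graph_idealP /(_ (fun x => aug x = 0)) H.
suff : aug 1 = 0 by rewrite rmorph1 => /eqP; rewrite oner_eq0.
apply: H.
  split=> [|x y hx hy|a x hx|a x hx]; first exact: raddf0.
  - by rewrite augB hx hy subr0.
  - by rewrite augM hx mulr0.
  - by rewrite augM hx mul0r.
have augP p : map_poly aug (path_poly p) = 'X^(size p).
  rewrite /path_poly rmorph_prod /=.
  elim: p => [|e p IH]; first by rewrite big_nil.
  rewrite big_cons IH /= rmorphB /= map_polyX map_polyC /=.
  by rewrite mcoeffU1 fm1_eq1 subr0 exprS.
have aug_coef p k : (0 < k)%N -> (0 < size p)%N -> aug (path_coef p k) = 0.
  move=> k0 p0; rewrite /path_coef -coef_map augP coefXn.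
  by rewrite ltn_eqF // ltn_subrL k0.
by move=> _ [e1 [p1 [e2 [p2 [k [_ _ _ /andP[k0 _] ->]]]]]];
  rewrite augB !aug_coef ?subr0.
Qed.

End GraphIdeal.

Section GraphAlgebra.
Variables (F : fieldType) (n : nat) (G : layered_graph n).
Local Notation T := (free_alg F G).
Local Notation I := (@graph_ideal F n G).

(* A(G). *)
Definition graph_alg : Type := Quotient.quot I.

HB.instance Definition _ := EqQuotient.on graph_alg.
HB.instance Definition _ := Choice.on graph_alg.
HB.instance Definition _ := GRing.Zmodule.on graph_alg.

Definition graph_alg_pi (x : T) : graph_alg := \pi x.
Local Notation pi := graph_alg_pi.

Lemma graph_alg_eq x y : (pi x == pi y) = (x - y \in I).
Proof. by rewrite /pi Quotient.idealrBE. Qed.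

Lemma graph_alg_eqP x y : reflect (pi x = pi y) (x - y \in I).
Proof. by rewrite -graph_alg_eq; apply: eqP. Qed.

Lemma graph_algK (a : graph_alg) : pi (repr a) = a.
Proof. exact: reprK. Qed.

Lemma graph_alg_piB : zmod_morphism pi.
Proof. by move=> x y; rewrite /pi !piE. Qed.
HB.instance Definition _ :=
  GRing.isZmodMorphism.Build T graph_alg pi graph_alg_piB.

Let piD x y : pi (x + y) = pi x + pi y. Proof. exact: raddfD. Qed.

Definition graph_alg_mul (a b : graph_alg) : graph_alg :=
  pi (repr a * repr b).
Definition graph_alg_scale (c : F) (a : graph_alg) : graph_alg :=
  pi (c *: repr a).

Lemma graph_alg_mulE x y : graph_alg_mul (pi x) (pi y) = pi (x * y).
Proof.
apply/graph_alg_eqP.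
set x' := repr (pi x); set y' := repr (pi y).
have xx' : x' - x \in I by apply/graph_alg_eqP; rewrite graph_algK.
have yy' : y' - y \in I by apply/graph_alg_eqP; rewrite graph_algK.
have -> : x' * y' - x * y = (x' - x) * y' + x * (y' - y).
  by rewrite mulrBl mulrBr addrA subrK.
by apply: rpredD; [apply: graph_idealMr|apply: graph_idealMl].
Qed.

Lemma graph_alg_scaleE c x : graph_alg_scale c (pi x) = pi (c *: x).
Proof.
apply/graph_alg_eqP; rewrite -scalerBr graph_idealZ //.
by apply/graph_alg_eqP; rewrite graph_algK.
Qed.

Let E := (graph_alg_mulE, graph_alg_scaleE).

Lemma graph_alg_mulA : associative graph_alg_mul.
Proof.
move=> a b c; rewrite -(graph_algK a) -(graph_algK b) -(graph_algK c).
by rewrite !E mulrA.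
Qed.
Lemma graph_alg_mul1r : left_id (pi 1) graph_alg_mul.
Proof. by move=> a; rewrite -(graph_algK a) E mul1r. Qed.
Lemma graph_alg_mulr1 : right_id (pi 1) graph_alg_mul.
Proof. by move=> a; rewrite -(graph_algK a) E mulr1. Qed.
Lemma graph_alg_mulDl : left_distributive graph_alg_mul +%R.
Proof.
move=> a b c; rewrite -(graph_algK a) -(graph_algK b) -(graph_algK c).
by rewrite -piD !E mulrDl piD.
Qed.
Lemma graph_alg_mulDr : right_distributive graph_alg_mul +%R.
Proof.
move=> a b c; rewrite -(graph_algK a) -(graph_algK b) -(graph_algK c).
by rewrite -piD !E mulrDr piD.
Qed.
Lemma graph_alg_1neq0 : pi 1 != 0.
Proof. by rewrite -(raddf0 pi) graph_alg_eq subr0 graph_ideal1. Qed.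

HB.instance Definition _ := GRing.Zmodule_isNzRing.Build graph_alg
  graph_alg_mulA graph_alg_mul1r graph_alg_mulr1
  graph_alg_mulDl graph_alg_mulDr graph_alg_1neq0.

Lemma graph_alg_scaleA c d a :
  graph_alg_scale c (graph_alg_scale d a) = graph_alg_scale (c * d) a.
Proof. by rewrite -(graph_algK a) !E scalerA. Qed.
Lemma graph_alg_scale1 : left_id 1 graph_alg_scale.
Proof. by move=> a; rewrite -(graph_algK a) E scale1r. Qed.
Lemma graph_alg_scaleDr : right_distributive graph_alg_scale +%R.
Proof.
move=> c a b; rewrite -(graph_algK a) -(graph_algK b).
by rewrite -piD !E scalerDr piD.
Qed.
Lemma graph_alg_scaleDl a : {morph graph_alg_scale^~ a : c d / c + d}.
Proof. by move=> c d; rewrite -(graph_algK a) !E scalerDl piD. Qed.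

HB.instance Definition _ := GRing.Zmodule_isLmodule.Build F graph_alg
  graph_alg_scaleA graph_alg_scale1 graph_alg_scaleDr graph_alg_scaleDl.

Lemma graph_alg_scalerAl (c : F) (a b : graph_alg) :
  c *: (a * b) = (c *: a) * b.
Proof.
rewrite -(graph_algK a) -(graph_algK b) /GRing.mul /GRing.scale /=.
by rewrite !E scalerAl.
Qed.
HB.instance Definition _ :=
  GRing.Lmodule_isLalgebra.Build F graph_alg graph_alg_scalerAl.

Lemma graph_alg_scalerAr (c : F) (a b : graph_alg) :
  c *: (a * b) = a * (c *: b).
Proof.
rewrite -(graph_algK a) -(graph_algK b) /GRing.mul /GRing.scale /=.
by rewrite !E free_scalerAr.
Qed.
HB.instance Definition _ :=
  GRing.Lalgebra_isAlgebra.Build F graph_alg graph_alg_scalerAr.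

Lemma graph_alg_pi_monoid : monoid_morphism pi.
Proof. by split=> // x y; rewrite -graph_alg_mulE. Qed.
HB.instance Definition _ :=
  GRing.isMonoidMorphism.Build T graph_alg pi graph_alg_pi_monoid.

Lemma graph_alg_pi_scalable : scalable pi.
Proof. by move=> c x; rewrite -graph_alg_scaleE. Qed.
HB.instance Definition _ :=
  GRing.isScalable.Build F T graph_alg *:%R pi graph_alg_pi_scalable.

Definition homogeneous (i : nat) (x : T) : Prop :=
  forall w, x@_w != 0 -> fdeg w = i.

(* A(G)_i, the image of the degree i component of the free algebra. *)
Definition graph_alg_deg (i : nat) (a : graph_alg) : Prop :=
  exists2 x : T, homogeneous i x & a = pi x.

End GraphAlgebra.

Section Dimension.
Variables (F : fieldType) (V : lmodType F).

Definition spans (S : V -> Prop) (d : nat) (b : 'I_d -> V) : Prop :=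
  forall x, S x -> exists c : 'I_d -> F, x = \sum_i c i *: b i.

Definition independent (d : nat) (b : 'I_d -> V) : Prop :=
  forall c : 'I_d -> F, \sum_i c i *: b i = 0 -> forall i, c i = 0.

Definition has_dim (S : V -> Prop) (d : nat) : Prop :=
  exists b : 'I_d -> V, [/\ forall i, S (b i), independent b & spans S b].

(* [S] is meant to be a linear subspace; the value is 0 by convention when no
   finite basis exists, a case excluded for A(G)_i by [graph_alg_deg_has_dim]. *)
Definition subdim (S : V -> Prop) : nat :=
  if pselect (exists d, has_dim S d) is left h then projT1 (cid h) else 0%N.

Lemma has_dim_le (S : V -> Prop) d d' :
  has_dim S d -> has_dim S d' -> (d' <= d)%N.
Proof.
move=> [b [_ _ bspan]] [b' [b'S b'free _]].
have /choice[M ME] i : exists c : 'I_d -> F, b' i = \sum_j c j *: b j.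
  exact: bspan.
pose A := \matrix_(i, j) M i j.
suff : row_free A.
  by rewrite -row_leq_rank => /leq_trans; apply; exact: rank_leq_col.
rewrite -kermx_eq0; apply/rowV0P => v /sub_kermxP vA.
apply/rowP => i; rewrite [RHS]mxE; apply: (b'free (fun i => v 0 i)).
under eq_bigr do rewrite ME scaler_sumr.
rewrite exchange_big big1 //= => j _.
under eq_bigr do rewrite scalerA.
rewrite -scaler_suml; move/rowP/(_ j): vA; rewrite !mxE => vA.
have -> : \sum_i v 0 i * M i j = 0.
  by rewrite -[RHS]vA; apply: eq_bigr => k _; rewrite mxE.
by rewrite scale0r.
Qed.

Lemma dimP (S : V -> Prop) d : has_dim S d -> subdim S = d.
Proof.
rewrite /subdim => Sd; case: pselect => [h|[]]; last by exists d.
case: cid => /= d' Sd'; apply/eqP.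
by rewrite eqn_leq !(has_dim_le Sd', has_dim_le Sd).
Qed.

Lemma spans_dim (S : V -> Prop) N (b : 'I_N -> V) :
  (forall i, S (b i)) -> spans S b -> exists d, has_dim S d.
Proof.
pose P N := `[< exists b : 'I_N -> V, (forall i, S (b i)) /\ spans S b >].
move=> bS bspan; have exP : exists N, P N by exists N; apply/asboolP; exists b.
have [d /asboolP[{N bS bspan}b [bS bspan]] dmin] := ex_minnP exP.
exists d, b; split=> // c c0 i; apply/eqP; apply: contraT => ci.
case: d => [|d] in b bS bspan dmin c c0 i ci *; first by have := ltn_ord i.
suff : P d by move/dmin; rewrite ltnn.
apply/asboolP; exists (fun j => b (lift i j)); split=> // x /bspan[a ->].
have bi : b i = \sum_j (- (c i)^-1 * c (lift i j)) *: b (lift i j).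
  move: c0; rewrite (bigD1_ord i) //= => /eqP; rewrite addr_eq0 => /eqP E.
  rewrite -[LHS]scale1r -(mulVf ci) -scalerA E scalerN scaler_sumr -sumrN.
  by apply: eq_bigr => j _; rewrite scalerA mulNr scaleNr.
exists (fun j => a (lift i j) + a i * (- (c i)^-1 * c (lift i j))).
rewrite (bigD1_ord i) //= bi scaler_sumr addrC -big_split /=.
by apply: eq_bigr => j _; rewrite scalerA scalerDl.
Qed.

End Dimension.

Lemma graph_alg_deg_has_dim (F : fieldType) n (G : layered_graph n) i :
  has_dim (@graph_alg_deg F n G i) (subdim (@graph_alg_deg F n G i)).
Proof.
suff [d Sd] : exists d, has_dim (@graph_alg_deg F n G i) d by rewrite (dimP Sd).
pose word (t : i.-tuple (edge G)) : free_alg F G := << FMonom t >>.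
pose b (j : 'I_#|{: i.-tuple (edge G)}|) := graph_alg_pi (word (enum_val j)).
apply: (@spans_dim _ _ _ _ b) => [j|_ [x xi ->]].
  exists (word (enum_val j)) => // w; rewrite mcoeffU1.
  case: (_ =P w) => [<- _|_]; last by rewrite eqxx.
  by rewrite fdegE size_tuple.
pose co (t : i.-tuple (edge G)) := x@_(FMonom t).
exists (fun j => co (enum_val j)).
have -> : x = \sum_(t : i.-tuple (edge G)) x@_(FMonom t) *: word t.
  apply/malgP => w; rewrite raddf_sum /=.
  under eq_bigr do rewrite mcoeffZ mcoeffU1.
  have [xw|/xi wi] := eqVneq (x@_w) 0.
    rewrite xw big1 // => t _; case: eqP => [->|_]; last by rewrite mulr0.
    by rewrite xw mul0r.
  have sw : size w == i by rewrite -wi.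
  have wE : FMonom (Tuple sw) = w by apply/eqP; rewrite fmP.
  rewrite (bigD1 (Tuple sw)) //= wE eqxx mulr1 big1 ?addr0 // => t tw.
  case: eqP => [E|_]; last by rewrite mulr0.
  by case/eqP: tw; apply: val_inj; rewrite /= -E.
rewrite raddf_sum /= (reindex (@enum_val _ predT)) /=; last first.
  exact/onW_bij/enum_val_bij.
by apply: eq_bigr => j _; rewrite linearZ.
Qed.

(* Formal power series, as coefficient sequences. *)
Section PowerSeries.
Variable K : fieldType.
Implicit Types f g : nat -> K.

Definition ps_of_poly (p : {poly K}) : nat -> K := fun i => p`_i.

Definition ps_mul f g : nat -> K := fun i => \sum_(j < i.+1) f j * g (i - j)%N.

(* First [i] coefficients of 1 / f, given by the recursion
   g_i = - f_0^-1 * \sum_(j < i) f_(i - j) * g_j, g_0 = f_0^-1; meaningful only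
   if f_0 != 0. *)
Fixpoint ps_inv_seq f (i : nat) : seq K :=
  if i is i'.+1 then
    let s := ps_inv_seq f i' in
    rcons s (if i' == 0%N then (f 0%N)^-1
             else - (f 0%N)^-1 * \sum_(j < i') f (i' - j)%N * s`_j)
  else [::].
Definition ps_inv f : nat -> K := fun i => (ps_inv_seq f i.+1)`_i.
Definition ps_div f g : nat -> K := ps_mul f (ps_inv g).

Lemma size_ps_inv_seq f i : size (ps_inv_seq f i) = i.
Proof. by elim: i => //= i IH; rewrite size_rcons IH. Qed.

Lemma nth_ps_inv_seq f i j : (j < i)%N -> (ps_inv_seq f i)`_j = ps_inv f j.
Proof.
elim: i => // i IH; rewrite ltnS leq_eqVlt => /predU1P[->//|ji].
by rewrite /= nth_rcons size_ps_inv_seq ji IH.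
Qed.

Lemma ps_mulV f : f 0%N != 0 -> ps_mul f (ps_inv f) =1 ps_of_poly 1.
Proof.
move=> f0 i; rewrite /ps_mul /ps_of_poly coef1 (reindex_inj rev_ord_inj) /=.
under eq_bigr => j _ do rewrite subSS (subKn (ltn_ord j : (j <= i)%N)).
rewrite big_ord_recr /= subnn {2}/ps_inv /= nth_rcons size_ps_inv_seq ltnn eqxx.
case: eqP => [->|i0]; first by rewrite big_ord0 add0r mulfV.
under [X in _ * (_ * X)]eq_bigr => j _ do rewrite nth_ps_inv_seq //.
by rewrite mulrA mulrN mulfV // mulN1r subrr.
Qed.

End PowerSeries.

(* H(A(G), t), as a power series with coefficients in Q. *)
Definition hilbert_series (F : fieldType) n (G : layered_graph n) : nat -> rat :=
  fun i => (subdim (@graph_alg_deg F n G i))%:R.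

(* m_a (m_(a-1) - 1) ... (m_(a-k+1) - 1) m_(a-k), read as m_a when k = 0. *)
Definition chain_term (m : nat -> nat) (a k : nat) : rat :=
  if k == 0%N then (m a)%:R
  else (m a)%:R * (\prod_((a - k).+1 <= j < a) ((m j)%:R - 1))
         * (m (a - k)%N)%:R.

(* Main.v *)
(** For [v] in layer [i >= 1] let [e_v] be the edge from [v] to a fixed base
vertex of layer [i - 1]; let [x_i] be [e_v] for the base vertex [v] of layer
[i], and [y_v = e_v - x_i] for the other [v] of layer [i].  The relations
coming from paths of length 2 imply all the others, and they turn A(G) into the
algebra generated by the [x_i] and [y_v] subject to
  [x_(i+1) y_u = y_u x_i + y_u y_u]  and  [y_v y_u = 0],
where [u] lies in layer [i] and [v] in layer [i + 1].  Read from left to right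
these rewriting rules are confluent: the words in which no letter of layer
[i + 1] is followed by some [y_u] with [u] in layer [i] form a basis.  They span
because their span is stable under left multiplication by letters.  They are
independent because left multiplication by normal forms is given by an explicit
rule which makes sense on all words and respects the relations.  Counting the
basis words by the layer of their first letter gives the Hilbert series. *)

From mathcomp Require Import all_boot all_order all_algebra ring.
From mathcomp Require Import finmap boolp monalg.
Require Import Defs.

Set Implicit Arguments.
Unset Strict Implicit.
Unset Printing Implicit Defensive.

Import GRing.Theory.
Local Open Scope ring_scope.

(** * Relators of length two *)

Section IdealPoly.
Variables (T : nzRingType) (K : T -> Prop).
Hypothesis idealK : two_sided_ideal K.

Lemma ideal0 : K 0. Proof. by case: idealK. Qed.

Lemma idealB x y : K x -> K y -> K (x - y).
Proof. by case: idealK => _ KB _ _; apply: KB. Qed.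

Lemma idealN x : K x -> K (- x).
Proof. by rewrite -sub0r; apply: idealB; apply: ideal0. Qed.

Lemma idealD x y : K x -> K y -> K (x + y).
Proof. by move=> Kx /idealN Ky; rewrite -[y]opprK; apply: idealB. Qed.

Lemma ideal_sum (I : Type) (r : seq I) (f : I -> T) :
  (forall i, K (f i)) -> K (\sum_(i <- r) f i).
Proof.
by move=> Kf; elim/big_ind: _ => //; [apply: ideal0|move=> *; apply: idealD].
Qed.

(** Coefficientwise membership; since ['X] is central, these polynomials form a two-sided ideal of
    [{poly T}]. *)
Definition ideal_poly (p : {poly T}) : Prop := forall k, K p`_k.

Lemma ideal_polyD p q : ideal_poly p -> ideal_poly q -> ideal_poly (p + q).
Proof. by move=> Kp Kq k; rewrite coefD; apply: idealD. Qed.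

Lemma ideal_polyMl p q : ideal_poly q -> ideal_poly (p * q).
Proof.
move=> Kq k; rewrite coefM; apply: ideal_sum => i.
by case: idealK => _ _ + _; apply.
Qed.

Lemma ideal_polyMr p q : ideal_poly p -> ideal_poly (p * q).
Proof.
move=> Kp k; rewrite coefM; apply: ideal_sum => i.
by case: idealK => _ _ _; apply.
Qed.

End IdealPoly.

Lemma mul_XsubCXsubC (T : nzRingType) (a b : T) :
  ('X - a%:P) * ('X - b%:P) = 'X^2 - (a + b)%:P * 'X + (a * b)%:P.
Proof.
rewrite mulrBl !mulrBr opprB -expr2 -(commr_polyX b%:P) -polyCM.
by rewrite addrACA -opprD [RHS]addrAC polyCD mulrDl (addrC (b%:P * _)).
Qed.

Lemma prod_XsubC2 (T : nzRingType) (I : Type) (f : I -> T) (a b : I) :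
  \prod_(i <- [:: a; b]) ('X - (f i)%:P) =
  'X^2 - (f a + f b)%:P * 'X + (f a * f b)%:P.
Proof. by rewrite !big_cons big_nil mulr1 mul_XsubCXsubC. Qed.

Lemma coef1_XsubC2 (T : nzRingType) (c d : T) :
  ('X^2 - c%:P * 'X + d%:P)`_1 = - c.
Proof. by rewrite coefD coefB coefXn coefMX !coefC /= addr0 sub0r. Qed.

Lemma coef0_XsubC2 (T : nzRingType) (c d : T) :
  ('X^2 - c%:P * 'X + d%:P)`_0 = d.
Proof. by rewrite coefD coefB coefXn coefMX !coefC /= subr0 add0r. Qed.

Lemma XsubC2_subr (T : nzRingType) (c d c' d' : T) :
  'X^2 - c%:P * 'X + d%:P - ('X^2 - c'%:P * 'X + d'%:P) =
  (d - d')%:P - (c - c')%:P * 'X.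
Proof.
rewrite !polyCB mulrBl opprB.
move: (_ * 'X) (_ * 'X) (d%:P) (d'%:P) 'X^2 => u u' v v' w.
rewrite opprD addrACA [LHS]addrC opprB (addrC (w - u')).
by congr (_ + _); rewrite addrA subrK.
Qed.

(** The intermediate product [y1 * z * q] differs from the first product only in its two leading
    factors and shares its leading factor with the second. *)
Lemma subr_mulA (T : pzRingType) (x1 x2 y1 z q r : T) :
  x1 * (x2 * q) - y1 * r = (x1 * x2 - y1 * z) * q + y1 * (z * q - r).
Proof. by rewrite mulrBl mulrBr !mulrA addrA subrK. Qed.

Section PathPolynomials.
Variables (n : nat) (G : layered_graph n).
Hypothesis complG : complete_layered G.

(** Each edge lowers the level by one, so paths with the same ends have the same length. *)
Lemma path_level (e : edge G) p : is_path e p ->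
  level (etail e) = (level (ehead (last e p)) + (size p).+1)%N :> nat.
Proof.
elim: p e => [|a p IH] e; first by rewrite addn1 levelE.
by rewrite /is_path /= => /andP[/eqP ea /IH ap]; rewrite levelE ea ap !addnS.
Qed.

Definition parallel2 (a b a' b' : edge G) : Prop :=
  [/\ ehead a = etail b, ehead a' = etail b', etail a = etail a'
    & ehead b = ehead b'].

Variables (T : nzRingType) (g : edge G -> T) (K : T -> Prop).
Hypothesis idealK : two_sided_ideal K.
Hypothesis K_add : forall a b a' b', parallel2 a b a' b' ->
  K (g a + g b - (g a' + g b')).
Hypothesis K_mul : forall a b a' b', parallel2 a b a' b' ->
  K (g a * g b - g a' * g b').
Local Notation P p := (\prod_(e <- p) ('X - (g e)%:P)).

(** Induction on the length. An edge [c] from the head of [e2] to the head of [a1] gives a third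
    path [e2], [c], [q1]: it differs from the first by a relation of length two, and from the second
    only in the shorter parallel paths [c :: q1] and [a2 :: q2]. *)
Lemma prod_XsubC_parallel e1 p1 e2 p2 :
  size p1 = size p2 -> is_path e1 p1 -> is_path e2 p2 ->
  etail e1 = etail e2 -> ehead (last e1 p1) = ehead (last e2 p2) ->
  ideal_poly K (P (e1 :: p1) - P (e2 :: p2)).
Proof.
elim: p1 e1 e2 p2 => [|a1 q1 IH] e1 e2 [|a2 q2] //=.
  move=> _ _ _ tE hE.
  (* Single edges with the same ends coincide in a complete graph. *)
  have [e [_ eU]] : exists! e, etail e = etail e1 /\ ehead e = ehead e1.
    by apply: complG; rewrite levelE.
  rewrite -(eU e1) // -(eU e2) ?subrr; last by rewrite tE hE.
  by move=> k; rewrite coef0; apply: ideal0.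
move=> [sz] /andP[/eqP ea1 aq1] /andP[/eqP ea2 aq2] tE hE.
have [c [[ct ch] _]] : exists! c, etail c = ehead e2 /\ ehead c = ehead a1.
  by apply: complG; apply: succn_inj; rewrite -levelE -tE levelE ea1 levelE.
have cq1 : is_path c q1.
  by case: q1 aq1 {IH sz hE} => //= b q; rewrite /is_path /= ch.
have lastc : ehead (last c q1) = ehead (last a1 q1).
  by case: q1 {IH sz hE aq1 cq1}.
have e1e2 : parallel2 e1 a1 e2 c by [].
rewrite big_cons [P (a1 :: q1)]big_cons [P (e2 :: _)]big_cons.
pose f e := 'X - (g e)%:P; rewrite (subr_mulA _ _ _ (f c)).
rewrite -[f c * P q1](big_cons _ _ _ _ xpredT f) /=.
apply: ideal_polyD => //.
  (* Both quadratics are monic, so only the coefficients 0 and 1 of their difference matter; they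
     come from [K_mul] and, up to sign, [K_add]. *)
  apply: ideal_polyMr => //; rewrite !mul_XsubCXsubC XsubC2_subr => k.
  rewrite coefB coefMX !coefC.
  by apply: idealB => //; case: k => [|[|k]] /=;
    [apply: K_mul | apply: ideal0 | apply: ideal0
    | apply: ideal0 | apply: K_add | apply: ideal0].
by apply: ideal_polyMl => //; apply: IH => //; rewrite ?ct // lastc.
Qed.

End PathPolynomials.

Section Relators.
Variables (F : fieldType) (n : nat) (G : layered_graph n).
Local Notation T := (free_alg F G).
Local Notation gen := (@edge_gen F n G).

Lemma path_poly2 (a b : edge G) :
  path_poly F [:: a; b] = 'X^2 - (gen a + gen b)%:P * 'X + (gen a * gen b)%:P.
Proof. exact: prod_XsubC2. Qed.

Lemma path_coef21 (a b : edge G) : path_coef F [:: a; b] 1 = - (gen a + gen b).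
Proof. by rewrite /path_coef path_poly2 coef1_XsubC2. Qed.

Lemma path_coef22 (a b : edge G) : path_coef F [:: a; b] 2 = gen a * gen b.
Proof. by rewrite /path_coef path_poly2 coef0_XsubC2. Qed.

(** By the exchange of edges above, vanishing on the graph ideal has to be checked only for paths of
    length two. *)
Lemma relator_ideal (K : T -> Prop) :
  complete_layered G -> two_sided_ideal K ->
  (forall a b a' b' : edge G, parallel2 a b a' b' ->
     K (gen a + gen b - (gen a' + gen b')) /\
     K (gen a * gen b - gen a' * gen b')) ->
  forall x, ideal_gen (@relator F n G) x -> K x.
Proof.
move=> complG idealK K2 x; apply=> // {}x.
move=> [e1 [p1 [e2 [p2 [k [[P1 P2] tE hE _ ->]]]]]].
have sz : size p1 = size p2.
  apply: succn_inj; apply: (@addnI (level (ehead (last e1 p1)))).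
  by rewrite -(path_level P1) [ehead _]hE -(path_level P2) [etail _]tE.
(* Equal lengths put both coefficients at the same index. *)
rewrite /path_coef /= sz -coefB.
by apply: (@prod_XsubC_parallel _ _ complG T) => // a b a' b' /K2[].
Qed.

Lemma relator_add a b a' b' : parallel2 a b a' b' ->
  ideal_gen (@relator F n G) (gen a + gen b - (gen a' + gen b')).
Proof.
move=> [ab ab' tE hE] K [_ KB _ _] KR.
(* The coefficient is minus the sum of the edges, so the two paths trade places. *)
suff : K (path_coef F [:: a'; b'] 1 - path_coef F [:: a; b] 1).
  by rewrite !path_coef21 opprK addrC.
apply: KR; exists a', [:: b'], a, [:: b], 1; split=> //.
by rewrite /is_path /= ab ab' !eqxx.
Qed.

Lemma relator_mul a b a' b' : parallel2 a b a' b' ->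
  ideal_gen (@relator F n G) (gen a * gen b - gen a' * gen b').
Proof.
move=> [ab ab' tE hE] K _ KR; rewrite -!path_coef22.
apply: KR; exists a, [:: b], a', [:: b'], 2; split=> //.
by rewrite /is_path /= ab ab' !eqxx.
Qed.

End Relators.

(** * Normal words and their generating function *)

Section PowerSeriesDivision.
Variable K : fieldType.
Implicit Types (f : nat -> K) (p q : {poly K}).

(** Strong induction: at index [i] only the term with [f 0] involves a coefficient not yet known to
    agree. *)
Lemma ps_inv_unique f p :
  f 0%N != 0 -> ps_mul f (ps_of_poly p) =1 ps_of_poly 1 ->
  ps_inv f =1 ps_of_poly p.
Proof.
move=> f0 fp i; elim/ltn_ind: i => i IH.
have := ps_mulV f0 i; rewrite -fp /ps_mul !big_ord_recl /= subn0.
have -> : \sum_(j < i) f (bump 0 j) * ps_inv f (i - bump 0 j) =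
          \sum_(j < i) f (bump 0 j) * ps_of_poly p (i - bump 0 j).
  apply: eq_bigr => j _; rewrite IH // ltn_subrL /bump.
  exact: leq_ltn_trans (ltn_ord j).
by move/addIr/(mulfI f0).
Qed.

Lemma ps_div_poly f p q :
  f 0%N != 0 -> ps_mul f (ps_of_poly p) =1 ps_of_poly 1 ->
  ps_div (ps_of_poly q) f =1 ps_of_poly (q * p).
Proof.
move=> f0 fp i; rewrite /ps_div /ps_mul /ps_of_poly coefM.
by apply: eq_bigr => j _; rewrite (ps_inv_unique f0 fp).
Qed.

Lemma ps_mulXS f p i :
  ps_mul f (ps_of_poly ('X * p)) i.+1 = ps_mul f (ps_of_poly p) i.
Proof.
rewrite /ps_mul /ps_of_poly big_ord_recr /= subnn coefXM eqxx mulr0 addr0.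
by apply: eq_bigr => j _; rewrite coefXM subSn // leq_ord.
Qed.

Lemma ps_mulB f p q i : ps_mul f (ps_of_poly (p - q)) i =
  ps_mul f (ps_of_poly p) i - ps_mul f (ps_of_poly q) i.
Proof.
rewrite /ps_mul -sumrB; apply: eq_bigr => j _.
by rewrite /ps_of_poly coefB mulrBr.
Qed.

Lemma ps_mulC f c p i :
  ps_mul f (ps_of_poly (c%:P * p)) i = c * ps_mul f (ps_of_poly p) i.
Proof.
rewrite /ps_mul mulr_sumr; apply: eq_bigr => j _.
by rewrite /ps_of_poly coefCM mulrCA.
Qed.

Lemma ps_mul1 f i : ps_mul f (ps_of_poly 1) i = f i.
Proof.
rewrite /ps_mul big_ord_recr /= big1 => [|j _].
  by rewrite /ps_of_poly subnn coef1 mulr1 add0r.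
by rewrite /ps_of_poly coef1 subn_eq0 leqNgt ltn_ord mulr0.
Qed.

Lemma ps_mul_sum f (I : Type) (r : seq I) (P : pred I) (g : I -> {poly K}) i :
  ps_mul f (ps_of_poly (\sum_(k <- r | P k) g k)) i =
  \sum_(k <- r | P k) ps_mul f (ps_of_poly (g k)) i.
Proof.
rewrite /ps_mul exchange_big; apply: eq_bigr => j _.
by rewrite /ps_of_poly coef_sum mulr_sumr.
Qed.

End PowerSeriesDivision.

(** * The polynomial identity behind the chain sum *)

Section ChainPolynomials.
Variable m : nat -> nat.

(* With H the generating function of all normal words, H * start_poly j is the
   one of the normal words with a given first letter of level j. *)
Fixpoint start_poly (j : nat) : {poly rat} :=
  if j is i.+1 then 'X * (1 - ((m i)%:R - 1)%:P * start_poly i) else 0.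

Lemma start_polyS j :
  start_poly j.+1 = 'X * (1 - ((m j)%:R - 1)%:P * start_poly j).
Proof. by []. Qed.

Lemma start_poly0 j : (start_poly j)`_0 = 0.
Proof. by case: j => [|j]; rewrite ?coef0 // coefXM. Qed.

(** [chain_term m a k] without its leading factor [m a], so that the sums over [k] below obey a
    recursion in [a]. *)
Let chain_quot (a k : nat) : rat :=
  if k == 0%N then 1
  else \prod_((a - k).+1 <= j < a) ((m j)%:R - 1) * (m (a - k)%N)%:R.

Let chain_poly a :=
  \sum_(0 <= k < a.+1) ((-1) ^+ k * chain_quot a k) *: 'X^(k.+1).

(** The terms for [k = 0] and [k = 1] are split off; each later product is the one for [a] with [k]
    lowered by one, times [m a - 1]. Subtracting ['X] removes the term [k = 0] of [chain_poly a]. *)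
Lemma chain_polyS a : chain_poly a.+1 =
  'X - (m a)%:R%:P * 'X^2 - ((m a)%:R - 1)%:P * 'X * (chain_poly a - 'X).
Proof.
have quot0 b : chain_quot b 0 = 1 by [].
rewrite /chain_poly big_nat_recl // big_nat_recl // [in RHS]big_nat_recl //.
rewrite !quot0 !expr0 mulr1 !scale1r expr1.
rewrite (addrC 'X (\sum_(_ <= _ < _) _)) addrK.
rewrite -addrA; congr (_ + _).
have -> : chain_quot a.+1 1 = (m a)%:R.
  by rewrite /chain_quot /= subn1 big_geq ?mul1r.
rewrite expr1 mulN1r -mul_polyC polyCN mulNr; congr (_ + _).
rewrite mulr_sumr -sumrN; apply: eq_big_nat => k /andP[_ ka].
have -> : chain_quot a.+1 k.+2 = chain_quot a k.+1 * ((m a)%:R - 1).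
  rewrite /chain_quot /= subSS big_nat_recr /=; first by rewrite mulrAC.
  by rewrite ltn_subrL (leq_ltn_trans _ ka).
rewrite -!mul_polyC !polyCM !rmorphXn /= polyCN polyC1 !exprS; ring.
Qed.

(** Both sides satisfy the same recursion. They agree at index 1 because [m 0 = 1] kills the
    recursive term, but not at index 0. *)
Lemma chain_poly_start a : m 0%N = 1%N ->
  (1 - 'X) * start_poly a.+1 = chain_poly a.+1.
Proof.
move=> m0; elim: a => [|a IH]; rewrite chain_polyS.
  by rewrite /= m0 subrr polyC0 polyC1; ring.
rewrite -IH start_polyS; set p := start_poly a.+1.
rewrite polyCB polyC1; set c := (m a.+1)%:R%:P; ring.
Qed.

Lemma chain_sum n : m 0%N = 1%N ->
  (1 - 'X) * (1 - \sum_(1 <= a < n.+1) (m a)%:R%:P * start_poly a) =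
  1 - \sum_(0 <= k < n.+1) \sum_(k <= a < n.+1)
        ((-1) ^+ k * chain_term m a k) *: 'X^(k.+1).
Proof.
move=> m0.
have -> : \sum_(0 <= k < n.+1) \sum_(k <= a < n.+1)
        ((-1) ^+ k * chain_term m a k) *: 'X^(k.+1) =
   \sum_(0 <= a < n.+1) (m a)%:R%:P * chain_poly a.
  pose t k a : {poly rat} := ((-1) ^+ k * chain_term m a k) *: 'X^(k.+1).
  transitivity (\sum_(0 <= k < n.+1) \sum_(0 <= a < n.+1 | (k <= a)%N) t k a).
    by apply: eq_bigr => k _; rewrite (big_nat_widenl k 0).
  rewrite (exchange_big_dep xpredT) //=; apply: eq_big_nat => a an.
  rewrite -(big_nat_widen 0 a.+1 n.+1 xpredT (fun k => t k a)) //=.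
  rewrite mulr_sumr; apply: eq_bigr => k _.
  rewrite /t -!mul_polyC mulrA -polyCM; congr (_%:P * _).
  rewrite mulrCA; congr (_ * _); rewrite /chain_term /chain_quot.
  by case: eqP; rewrite ?mulr1 // mulrA.
(* The term [a = 0] is ['X]; it completes the leading 1 to the factor [1 - 'X]. *)
rewrite [in RHS]big_nat_recl // m0 polyC1 mul1r.
have -> : chain_poly 0 = 'X by rewrite /chain_poly big_nat1 mulr1 scale1r.
rewrite big_add1 /= mulrBr mulr1 mulr_sumr opprD addrA; congr (_ - _).
by apply: eq_bigr => a _; rewrite mulrCA chain_poly_start.
Qed.

End ChainPolynomials.

(** * Enumeration of normal words by their first letter *)

Section NormalWords.
Variables (V : finType) (lev : V -> nat) (base : pred V).

(** A base vertex stands for the letter x of its level, any other vertex [u] for y_u; only the y one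
    level below [v] may not follow [v]. *)
Definition admissible (v u : V) : bool := base u || (lev v != (lev u).+1).

Definition admissible_head (v : V) (w : seq V) : bool :=
  if w is u :: _ then admissible v u else true.

(** Vertices of level 0 have no outgoing edge, hence give no letter. *)
Definition normal (w : seq V) : bool :=
  all (fun v => 0 < lev v)%N w && sorted admissible w.

Lemma normal_cons v w :
  normal (v :: w) = [&& (0 < lev v)%N, admissible_head v w & normal w].
Proof.
case: w => [|u w]; rewrite /normal /= ?andbT //.
by case: (0 < lev v)%N; case: admissible => //=; rewrite andbF.
Qed.

Definition letters : seq V := enum [pred v | (0 < lev v)%N].

Lemma mem_letters v : (v \in letters) = (0 < lev v)%N.
Proof. by rewrite mem_enum. Qed.

Fixpoint normal_words (d : nat) : seq (seq V) :=
  if d is d'.+1 then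
    [seq v :: w | v <- letters,
                  w <- [seq w <- normal_words d' | admissible_head v w]]
  else [:: [::]].

Lemma mem_normal_words d w : (w \in normal_words d) = (size w == d) && normal w.
Proof.
elim: d w => [|d IH] w /=.
  by rewrite inE -size_eq0; case: eqP => // /size0nil->.
apply/allpairsPdep/idP => [[v [w' [vl]]]|].
  rewrite mem_filter IH => /and3P[aw /eqP sw nw] ->.
  by rewrite normal_cons aw nw -mem_letters vl /= sw eqxx.
case: w => // v w; rewrite normal_cons eqSS => /and4P[sw v0 aw nw].
by exists v, w; split; rewrite ?mem_letters // mem_filter aw IH sw nw.
Qed.

Lemma uniq_normal_words d : uniq (normal_words d).
Proof.
elim: d => //= d IH; apply: allpairs_uniq_dep => [|v _|].
- exact: enum_uniq.
- exact: filter_uniq.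
- by move=> [v w] [v' w'] _ _ /= [-> ->].
Qed.

Definition starts (v : V) (w : seq V) : bool := ohead w == Some v.

Lemma count_starts_sum (P : pred V) d :
  (count (fun w => if w is u :: _ then P u else false) (normal_words d) =
   \sum_(u | P u) count (starts u) (normal_words d))%N.
Proof.
elim: (normal_words d) => [|[|u w] s IH]; [by rewrite big1|exact: IH|rewrite /=].
rewrite IH big_split /=; congr (_ + _)%N.
rewrite big_mkcond (bigD1 u) //= /starts /= eqxx big1 ?addn0 => [|v vu].
  by case: (P u).
by case: ifP => // _; case: eqP => // -[] /eqP; rewrite eq_sym (negPf vu).
Qed.

(** Deleting the first letter [v] is a bijection onto the shorter normal words that [v] may
    precede. *)
Lemma count_startsS v d : (0 < lev v)%N ->
  count (starts v) (normal_words d.+1) =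
  count (admissible_head v) (normal_words d).
Proof.
move=> v0 /=; rewrite count_flatten -map_comp.
rewrite -size_filter sumnE big_map.
have vl : v \in letters by rewrite mem_letters.
rewrite (bigD1_seq v) ?enum_uniq //= big1 => [|u uv].
  rewrite addn0 count_map; apply/eqP; rewrite -all_count; apply/allP => w _.
  by rewrite /starts /= eqxx.
rewrite count_map -(count_pred0 [seq w <- normal_words d | admissible_head u w]).
apply: eq_count => w /=; apply/negbTE.
by apply: contra uv => /eqP[->].
Qed.

Variables (n : nat) (m : nat -> nat).
Hypothesis lev_le : forall v, (lev v <= n)%N.
Hypothesis m0 : m 0%N = 1%N.
Hypothesis card_lev : forall i, (i <= n)%N -> #|[pred v | lev v == i]| = m i.
Hypothesis card_nonbase : forall i, (i <= n)%N ->
  (#|[pred v | (lev v == i) && ~~ base v]|.+1 = m i)%N.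

Let N d : rat := (size (normal_words d))%:R.

(** Induction on the length: deleting the first letter leaves all normal words but those it may not
    precede, which is the recursion of [start_poly]. *)
Lemma count_starts v d : (0 < lev v)%N ->
  (count (starts v) (normal_words d))%:R =
  ps_mul N (ps_of_poly (start_poly m (lev v))) d.
Proof.
elim: d v => [|d IH] v v0.
  by rewrite /ps_mul big_ord1 /ps_of_poly subnn start_poly0 mulr0.
rewrite count_startsS // -(prednK v0) start_polyS.
rewrite ps_mulXS ps_mulB ps_mul1 ps_mulC.
set j := (lev v).-1.
have jn : (j <= n)%N by apply: leq_trans (leq_pred _) (lev_le v).
(* The excluded words begin with one of the [m j - 1] nonbase letters of the level [j] just below
   [v]. *)
have E : (count (predC (admissible_head v)) (normal_words d))%:R =
    ((m j)%:R - 1) * ps_mul N (ps_of_poly (start_poly m j)) d.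
  pose bad w := if w is u :: _ then ~~ admissible v u else false.
  rewrite (eq_count (a2 := bad)); last by case.
  rewrite count_starts_sum natr_sum.
  rewrite (eq_bigr (fun _ => ps_mul N (ps_of_poly (start_poly m j)) d)) => [|u].
    rewrite sumr_const -[in RHS](card_nonbase jn) -natr1 addrK mulr_natl.
    congr (_ *+ _); apply: eq_card => u.
    rewrite unfold_in inE /admissible negb_or negbK andbC.
    by rewrite -{1}(prednK v0) eqSS eq_sym.
  rewrite /admissible negb_or negbK -(prednK v0) eqSS => /andP[bu /eqP ju].
  (* Since [m 0 = 1], level 0 contains no nonbase vertex. *)
  suff /IH -> : (0 < lev u)%N by rewrite -ju.
  rewrite lt0n; apply: contra bu => /eqP u0.
  have := card_nonbase (leq0n n); rewrite m0 => -[] /card0_eq/(_ u).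
  by rewrite !inE u0 eqxx => /negbFE.
by rewrite -E /N -(count_predC (admissible_head v)) natrD addrK.
Qed.

(** A nonempty normal word has exactly one first letter, and each level [a >= 1] offers [m a]
    choices with equal counts. *)
Lemma normal_words_series :
  ps_mul N (ps_of_poly (1 - \sum_(1 <= a < n.+1) (m a)%:R%:P * start_poly m a))
  =1 ps_of_poly 1.
Proof.
move=> [|d].
  rewrite /ps_mul big_ord1 /ps_of_poly subnn coefB coef_sum big1 ?subr0 ?mul1r //.
  by move=> a _; rewrite coefCM start_poly0 mulr0.
rewrite ps_mulB ps_mul1 ps_mul_sum /ps_of_poly coef1 /=.
apply/eqP; rewrite subr_eq0.
have -> : N d.+1 =
    \sum_(v | (0 < lev v)%N) (count (starts v) (normal_words d.+1))%:R.
  rewrite -natr_sum -(count_starts_sum (fun v => 0 < lev v)%N); congr (_%:R).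
  apply/esym/eqP; rewrite -all_count; apply/allP => -[|v w].
    by rewrite mem_normal_words.
  by rewrite mem_normal_words normal_cons => /and3P[].
rewrite (eq_bigr _ (fun v v0 => count_starts d.+1 v0)).
rewrite big_add1 big_mkord; apply/eqP.
rewrite (partition_big (fun v => inord (lev v) : 'I_n.+1) xpredT) //=.
rewrite big_ord_recl big1 ?add0r => [|v /andP[v0 /eqP/(congr1 val)]]; last first.
  by rewrite /= inordK ?ltnS // => v00; rewrite v00 in v0.
apply: eq_bigr => i _.
rewrite ps_mulC mulr_natl -(card_lev (ltn_ord i)) -sumr_const.
apply: eq_big => [v|v /andP[_ /eqP/(congr1 val)]].
  rewrite inE -val_eqE /= inordK ?ltnS // andbC.
  by case: eqP => // ->.
by rewrite /= inordK ?ltnS // => ->.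
Qed.

End NormalWords.

(** * The algebra of a complete layered graph *)

(** [X - y] and [x + y] will be the edges of a path through a nonbase vertex, [X] and [x] those of
    the parallel path through the base vertex. *)
Lemma exchange_relation (A : nzRingType) (X x y : A) :
  (X - y) * (x + y) = X * x -> X * y = y * x + y * y.
Proof.
rewrite mulrBl !mulrDr -addrA -[RHS]addr0 => /addrI/eqP.
by rewrite subr_eq0 => /eqP.
Qed.

Section CompleteGraph.
Variables (F : fieldType) (n : nat) (G : layered_graph n).
Hypothesis complG : complete_layered G.
Variables (b : nat -> vert G) (ed : vert G -> vert G -> edge G).
Hypothesis level_b : forall i, (i <= n)%N -> level (b i) = i :> nat.
Hypothesis level0 : forall v : vert G, level v = 0%N :> nat -> v = b 0.
Hypothesis edP : forall v w : vert G, level v = (level w).+1 :> nat ->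
  etail (ed v w) = v /\ ehead (ed v w) = w.

Local Notation T := (free_alg F G).
Local Notation gen := (@edge_gen F n G).
Local Notation W := (seq (vert G)).
Local Notation lev v := (nat_of_ord (level v)).

Definition is_base (v : vert G) : bool := v == b (lev v).
Local Notation adm := (admissible_head (fun v : vert G => lev v) is_base).

Lemma base_b i : (i <= n)%N -> is_base (b i).
Proof. by move=> /level_b bi; rewrite /is_base bi. Qed.

Lemma base_bl (v : vert G) : is_base (b (lev v)).
Proof. exact/base_b/leq_ord. Qed.

Lemma level_bl (v : vert G) : lev (b (lev v)) = lev v.
Proof. exact/level_b/leq_ord. Qed.

Lemma level_gt0 (v : vert G) : ~~ is_base v -> (0 < lev v)%N.
Proof.
by rewrite lt0n; apply: contra => /eqP v0; rewrite /is_base v0 [v]level0.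
Qed.

Lemma inadmissible (v u : vert G) (w : W) :
  lev v = (lev u).+1 -> ~~ is_base u -> adm v (u :: w) = false.
Proof. by move=> vu bu; rewrite /= /admissible (negPf bu) vu eqxx. Qed.

Local Notation normalG := (normal (fun v : vert G => lev v) is_base).
Local Notation nwords := (normal_words (fun v : vert G => lev v) is_base).

(** The ring is arbitrary so that the same words can be formed in the free algebra and in its
    quotient. *)
Definition letter_of (A : nzRingType) (e : vert G -> vert G -> A) (v : vert G) :
    A :=
  if is_base v then e v (b (lev v).-1)
  else e v (b (lev v).-1) - e (b (lev v)) (b (lev v).-1).

Definition word_of (A : nzRingType) (e : vert G -> vert G -> A) (w : W) : A :=
  \prod_(v <- w) letter_of e v.

Lemma rmorph_word (A B : nzRingType) (f : {rmorphism A -> B}) e w :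
  f (word_of e w) = word_of (fun v u => f (e v u)) w.
Proof.
rewrite /word_of rmorph_prod; apply: eq_bigr => v _.
by rewrite /letter_of; case: ifP => // _; rewrite rmorphB.
Qed.

(** * Normal words span *)

Section Span.
Variables (A : algType F) (e : vert G -> vert G -> A).
Hypothesis e_add : forall v u u' z : vert G,
  lev v = (lev u).+1 -> lev u' = lev u -> lev u = (lev z).+1 ->
  e v u + e u z = e v u' + e u' z.
Hypothesis e_mul : forall v u u' z : vert G,
  lev v = (lev u).+1 -> lev u' = lev u -> lev u = (lev z).+1 ->
  e v u * e u z = e v u' * e u' z.

Local Notation letter := (letter_of e).
Local Notation word := (word_of e).
Local Notation down v := (e v (b (lev v).-1)).

Lemma letter_base (v : vert G) : is_base v -> letter v = down v.
Proof. by rewrite /letter_of => ->. Qed.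

Lemma letter_nonbase (v : vert G) : ~~ is_base v ->
  letter v = down v - letter (b (lev v)).
Proof. by rewrite /letter_of => /negPf->; rewrite base_bl level_bl. Qed.

Lemma level_pred (u : vert G) : ~~ is_base u -> lev u = (lev (b (lev u).-1)).+1.
Proof.
move=> bu; rewrite level_b ?prednK ?level_gt0 //.
by rewrite (leq_trans (leq_pred _)) ?leq_ord.
Qed.

(** The additive relation compares the path through [u] with the one through the base vertex of its
    level; thus the letters generate all edges. *)
Lemma edge_letter (v u : vert G) : lev v = (lev u).+1 -> ~~ is_base u ->
  e v u = down v - letter u.
Proof.
move=> vu bu; rewrite letter_nonbase // letter_base ?base_bl // level_bl.
rewrite opprB addrA vu -[(lev u).+1.-1]/(lev u).
by rewrite -(e_add vu (level_bl u) (level_pred bu)) addrK.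
Qed.

Lemma down_letter (v u : vert G) : lev v = (lev u).+1 -> ~~ is_base u ->
  down v * letter u = letter u * letter (b (lev u)) + letter u * letter u.
Proof.
move=> vu bu; apply: exchange_relation; rewrite -edge_letter //.
have -> : letter (b (lev u)) + letter u = e u (b (lev u).-1).
  by rewrite (letter_nonbase bu) addrC subrK.
rewrite (e_mul vu (level_bl u) (level_pred bu)) letter_base ?base_bl // level_bl.
by rewrite vu.
Qed.

Lemma base_letter (v u : vert G) :
  lev v = (lev u).+1 -> is_base v -> ~~ is_base u ->
  letter v * letter u = letter u * letter (b (lev u)) + letter u * letter u.
Proof. by move=> vu bv bu; rewrite (letter_base bv) down_letter. Qed.

(** By [down_letter], the product [down v * letter u] depends on [v] only through its level, so the
    two terms of [letter v] cancel. *)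
Lemma nonbase_letter (v u : vert G) :
  lev v = (lev u).+1 -> ~~ is_base v -> ~~ is_base u -> letter v * letter u = 0.
Proof.
move=> vu bv bu; rewrite (letter_nonbase bv) letter_base ?base_bl // mulrBl.
by rewrite !down_letter ?subrr // level_bl.
Qed.

Lemma edgeE (v u : vert G) : lev v = (lev u).+1 ->
  exists c : vert G -> F, e v u = \sum_(x | (0 < lev x)%N) c x *: letter x.
Proof.
move=> vu; have v0 : (0 < lev v)%N by rewrite vu.
pose S a := exists c : vert G -> F, a = \sum_(x | (0 < lev x)%N) c x *: letter x.
have S1 x : (0 < lev x)%N -> S (letter x).
  move=> x0; exists (fun y => (y == x)%:R); rewrite (bigD1 x) //= eqxx scale1r.
  by rewrite big1 ?addr0 // => y /andP[_ /negPf->]; rewrite scale0r.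
have SD a c : S a -> S c -> S (a + c).
  move=> [k ->] [l ->]; exists (fun x => k x + l x).
  by rewrite -big_split; apply: eq_bigr => x _; rewrite scalerDl.
have SN a : S a -> S (- a).
  move=> [k ->]; exists (fun x => - k x).
  by rewrite -sumrN; apply: eq_bigr => x _; rewrite scaleNr.
have Sdown : S (down v).
  have [bv|bv] := boolP (is_base v); first by rewrite -letter_base //; apply: S1.
  have -> : down v = letter v + letter (b (lev v)).
    by rewrite (letter_nonbase bv) subrK.
  by apply: SD; apply: S1; rewrite ?level_bl.
have [bu|bu] := boolP (is_base u).
  by move: Sdown; rewrite vu /=; move/eqP: bu => <-.
by rewrite (edge_letter vu bu); apply: SD => //; apply/SN/S1/level_gt0.
Qed.

Definition normal_span (d : nat) (a : A) : Prop :=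
  exists c : W -> F, a = \sum_(w <- nwords d) c w *: word w.

Lemma normal_spanD d x y :
  normal_span d x -> normal_span d y -> normal_span d (x + y).
Proof.
move=> [k ->] [l ->]; exists (fun x => k x + l x).
by rewrite -big_split; apply: eq_bigr => w _; rewrite scalerDl.
Qed.

Lemma normal_spanZ d c x : normal_span d x -> normal_span d (c *: x).
Proof.
move=> [k ->]; exists (fun x => c * k x).
by rewrite scaler_sumr; apply: eq_bigr => w _; rewrite scalerA.
Qed.

Lemma normal_span0 d : normal_span d 0.
Proof. by exists (fun=> 0); rewrite big1 // => w _; rewrite scale0r. Qed.

Lemma normal_span_sum d (I : eqType) (r : seq I) (P : pred I) (g : I -> A) :
  (forall i, i \in r -> P i -> normal_span d (g i)) ->
  normal_span d (\sum_(i <- r | P i) g i).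
Proof.
move=> Sg; rewrite big_seq_cond.
by elim/big_ind: _ => [|x y|i /andP[]];
  [exact: normal_span0|exact: normal_spanD|exact: Sg].
Qed.

Lemma normal_span_word w : normalG w -> normal_span (size w) (word w).
Proof.
move=> nw; exists (fun x => (x == w)%:R).
have wn : w \in nwords (size w) by rewrite mem_normal_words eqxx nw.
rewrite (bigD1_seq w) ?uniq_normal_words //= eqxx scale1r.
by rewrite big1 ?addr0 // => x /negPf->; rewrite scale0r.
Qed.

Lemma word_cons v w : word (v :: w) = letter v * word w.
Proof. by rewrite /word_of big_cons. Qed.

(** A letter put before a normal word creates at most one reducible pair, at the front, and a single
    rewriting step removes it. *)
Lemma normal_span_letter v d a : (0 < lev v)%N ->
  normal_span d a -> normal_span d.+1 (letter v * a).
Proof.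
move=> v0 [c ->]; rewrite mulr_sumr; apply: normal_span_sum => w.
rewrite mem_normal_words => /andP[/eqP <- nw] _; rewrite -scalerAr.
apply: normal_spanZ; rewrite -word_cons.
have [vw|] := boolP (adm v w).
  by apply: (@normal_span_word (v :: w)); rewrite normal_cons v0 vw.
case: w nw => // u w nw; rewrite /= /admissible negb_or negbK => /andP[bu /eqP vu].
rewrite !word_cons mulrA; have [bv|bv] := boolP (is_base v); last first.
  by rewrite (nonbase_letter vu) // mul0r; apply: normal_span0.
(* Both new words are normal: [b (lev u)] has the level of [u], so it may precede the same words,
   and letters of equal level may follow each other. *)
rewrite (base_letter vu) // mulrDl -!mulrA -!word_cons.
have u0 := level_gt0 bu.
have nuu : normalG [:: u, u & w].
  by rewrite normal_cons u0 /= /admissible (ltn_eqF (leqnn _)) orbT.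
apply: normal_spanD; last exact: (@normal_span_word [:: u, u & w]).
apply: (@normal_span_word [:: u, b (lev u) & w]).
move: nw; rewrite !normal_cons level_bl u0 /= /admissible base_bl /= => /andP[uw ->].
by case: (w) uw => //= x w'; rewrite /admissible level_bl => ->.
Qed.

Lemma normal_span_path (t : seq (edge G)) :
  normal_span (size t) (\prod_(a <- t) e (etail a) (ehead a)).
Proof.
elim: t => [|a t IH].
  rewrite big_nil; have -> : 1 = word [::] by rewrite /word_of big_nil.
  exact: (@normal_span_word [::]).
rewrite big_cons; have [c ->] := edgeE (levelE a); rewrite mulr_suml.
apply: normal_span_sum => v _ v0.
by rewrite -scalerAl; apply/normal_spanZ/normal_span_letter.
Qed.

End Span.

(* [xop i] and [yop v] are the transposes of the left multiplications by [x_i]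
   and [y_v] on words, where a product whose first two letters form a reducible
   pair is rewritten; the one by the edge from [v] to [u] is
   [x_(lev v) + y_v - y_u].  On functions no linear extension is needed. *)
Definition xop (i : nat) (f : W -> F) (w : W) : F :=
  if adm (b i) w then f (b i :: w)
  else if w is u :: w' then f [:: u, b (lev u) & w'] + f [:: u, u & w'] else 0.

Definition yop (v : vert G) (f : W -> F) (w : W) : F :=
  if is_base v || ~~ adm v w then 0 else f (v :: w).

Definition eop (v u : vert G) (f : W -> F) (w : W) : F :=
  xop (lev v) f w + yop v f w - yop u f w.

(** * The relations between the transposed operators *)

Lemma xop_sum i (I : Type) (s : seq I) (c : I -> F) (g : I -> W -> F) w :
  xop i (fun w => \sum_(k <- s) c k * g k w) w =
  \sum_(k <- s) c k * xop i (g k) w.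
Proof.
rewrite /xop; case: ifP => // _; case: w => [|u w].
  by rewrite big1 // => k _; rewrite mulr0.
by rewrite -big_split; apply: eq_bigr => k _; rewrite mulrDr.
Qed.

Lemma yop_sum v (I : Type) (s : seq I) (c : I -> F) (g : I -> W -> F) w :
  yop v (fun w => \sum_(k <- s) c k * g k w) w =
  \sum_(k <- s) c k * yop v (g k) w.
Proof.
by rewrite /yop; case: ifP => // _; rewrite big1 // => k _; rewrite mulr0.
Qed.

Lemma eop_sum v u (I : Type) (s : seq I) (c : I -> F) (g : I -> W -> F) w :
  eop v u (fun w => \sum_(k <- s) c k * g k w) w =
  \sum_(k <- s) c k * eop v u (g k) w.
Proof.
rewrite /eop xop_sum !yop_sum -big_split -sumrB.
by apply: eq_bigr => k _; rewrite mulrBr mulrDr.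
Qed.

Lemma xopB i f g w : xop i (fun w => f w - g w) w = xop i f w - xop i g w.
Proof.
rewrite /xop; case: ifP => // _; case: w => [|u w]; first by rewrite subr0.
by rewrite opprD addrACA.
Qed.

Lemma yopB v f g w : yop v (fun w => f w - g w) w = yop v f w - yop v g w.
Proof. by rewrite /yop; case: ifP; rewrite ?subr0. Qed.

Lemma yopD v f g w : yop v (fun w => f w + g w) w = yop v f w + yop v g w.
Proof. by rewrite /yop; case: ifP; rewrite ?addr0. Qed.

(** The rule x_(i+1) y_u = y_u x_i + y_u y_u, with the order of composition reversed by
    transposition. *)
Lemma yop_xop (v u : vert G) f w : lev v = (lev u).+1 ->
  yop u (xop (lev v) f) w = xop (lev u) (yop u f) w + yop u (yop u f) w.
Proof.
move=> vu; have [bu|bu] := boolP (is_base u).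
  rewrite /yop /xop bu /= addr0; case: ifP => // _.
  by case: w => // a w; rewrite addr0.
have bvu w' : adm (b (lev v)) (u :: w') = false.
  by rewrite inadmissible // level_bl.
have [auw|] := boolP (adm u w).
  rewrite /yop (negPf bu) auw /= {1}/xop bvu.
  rewrite {1}/admissible (ltn_eqF (leqnn _)) orbT /=.
  rewrite /xop; congr (_ + _).
  have -> : adm (b (lev u)) w.
    by case: w auw {bvu} => //= a w; rewrite /admissible level_bl.
  by rewrite /= /admissible base_bl.
move=> naw; rewrite /yop (negPf bu) naw /=; move: naw.
(* Here [u] may not precede [a], and the words rewritten by [xop] again begin with [a], so [yop u]
   kills everything. *)
case: w => //= a w; rewrite /admissible negb_or negbK => /andP[ba /eqP ua].
rewrite addr0 /xop /= /admissible (negPf ba) level_bl ua eqxx /=.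
by rewrite addr0.
Qed.

Lemma yop_yop (v u : vert G) f w : lev v = (lev u).+1 -> yop u (yop v f) w = 0.
Proof.
move=> vu; rewrite /yop; case: ifP => // /norP[bu _].
by rewrite inadmissible ?orbT.
Qed.

(* The middle vertex [u] enters the right-hand side only through its level. *)
Lemma eop_eop (v u z : vert G) f w : lev v = (lev u).+1 -> lev u = (lev z).+1 ->
  eop u z (eop v u f) w =
  xop (lev u) (fun w => xop (lev v) f w + yop v f w) w
  - yop z (fun w => xop (lev v) f w + yop v f w) w.
Proof.
move=> vu uz; rewrite {1}/eop /eop !(xopB, yopB) yopD yop_xop //.
rewrite (yop_yop _ _ vu) (yop_yop _ _ uz).
ring.
Qed.

(** Transposes compose in reverse order, hence the left fold: the first edge of [t] acts on [f]
    first. *)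
Definition wop (t : seq (edge G)) (f : W -> F) : W -> F :=
  foldl (fun f e => eop (etail e) (ehead e) f) f t.

Lemma wop_sum t (I : Type) (s : seq I) (c : I -> F) (g : I -> W -> F) w :
  wop t (fun w => \sum_(k <- s) c k * g k w) w =
  \sum_(k <- s) c k * wop t (g k) w.
Proof.
elim: t g => //= e t IH g; rewrite -IH; congr (wop t _ w).
by apply/funext => w'; rewrite eop_sum.
Qed.

(** The value of the linear extension of [f] at the product of [a] with the word [w]. *)
Definition eval (a : T) (f : W -> F) (w : W) : F :=
  \sum_(k <- msupp a) a@_k * wop k f w.

Lemma eval_mmap a f w :
  eval a f w = mmap idfun (fun k : {fmonom edge G} => wop k f w) a.
Proof. by []. Qed.

Lemma evalD x y f w : eval (x + y) f w = eval x f w + eval y f w.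
Proof. by rewrite !eval_mmap mmapD. Qed.

Lemma evalB x y f w : eval (x - y) f w = eval x f w - eval y f w.
Proof. by rewrite !eval_mmap mmapB. Qed.

Lemma eval0 f w : eval 0 f w = 0.
Proof. by rewrite eval_mmap mmap0. Qed.

Lemma eval1 f w : eval 1 f w = f w.
Proof. by rewrite eval_mmap mmapU mul1r fm1. Qed.

Lemma eval_gen e f w : eval (gen e) f w = eop (etail e) (ehead e) f w.
Proof. by rewrite eval_mmap mmapU mul1r fmuE. Qed.

Lemma evalM x y f w : eval (x * y) f w = eval y (eval x f) w.
Proof.
rewrite eval_mmap malgME raddf_sum /=.
transitivity (\sum_(k <- msupp x) \sum_(l <- msupp y)
    x@_k * y@_l * wop l (wop k f) w).
  apply: eq_bigr => k _; rewrite raddf_sum; apply: eq_bigr => l _.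
  by rewrite /= mmapU fmM /wop foldl_cat.
rewrite exchange_big /=; apply: eq_bigr => l _; rewrite /eval wop_sum mulr_sumr.
by apply: eq_bigr => k _; rewrite mulrA (mulrC y@_l).
Qed.

Lemma evalZ c x f w : eval (c *: x) f w = c * eval x f w.
Proof.
rewrite eval_mmap (mmapEw (msuppZ_le c x)) /eval mulr_sumr.
by apply: eq_bigr => k _; rewrite mcoeffZ mulrA.
Qed.

Lemma eval_addB x y x' y' f w : eval (x + y - (x' + y')) f w =
  eval x f w + eval y f w - (eval x' f w + eval y' f w).
Proof. by rewrite evalB !evalD. Qed.

Lemma eval_mulB x y x' y' f w :
  eval (x * y - x' * y') f w = eval y (eval x f) w - eval y' (eval x' f) w.
Proof. by rewrite (evalB (x * y)); congr (_ - _); apply: evalM. Qed.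

Lemma eval_eq0 x w : eval x (fun=> 0) w = 0.
Proof.
(* The zero function is written as an empty linear combination to apply [wop_sum]. *)
rewrite /eval big1 // => k _; pose g (i : void) (w : W) : F := 0.
have -> : (fun=> 0) = fun w : W => \sum_(i <- [::]) 0 * g i w.
  by apply/funext => w'; rewrite big_nil.
by rewrite wop_sum big_nil mulr0.
Qed.

(** The elements acting by zero form a two-sided ideal, so only parallel paths of length two need
    comparison: the sum loses the middle vertex by cancellation, the product by [eop_eop]. *)
Lemma eval_ideal x : x \in @graph_ideal F n G -> forall f w, eval x f w = 0.
Proof.
move=> /graph_idealP; pose K x := forall f w, eval x f w = 0.
apply: (@relator_ideal _ _ _ K) => //.
  split=> [f w|x' y hx hy f w|a x' hx f w|a x' hx f w].
  - exact: eval0.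
  - by rewrite evalB hx hy subr0.
  - by rewrite evalM hx.
  - have f0 : eval x' f = fun=> 0 by apply/funext => w'; rewrite hx.
    by rewrite evalM f0 eval_eq0.
move=> a c a' c' [ac ac' tE hE].
have ta := levelE a; have tc := levelE c.
have ta' := levelE a'; have tc' := levelE c'.
have uu' : lev (ehead a) = lev (ehead a').
  by apply: succn_inj; rewrite -ta -ta' tE.
split=> f w.
  rewrite eval_addB (eval_gen a) (eval_gen a') (eval_gen c) (eval_gen c').
  by rewrite /eop -tE -hE -ac -ac' uu'; ring.
have evalE e : eval (gen e) f = eop (etail e) (ehead e) f.
  by apply/funext => w'; rewrite eval_gen.
rewrite eval_mulB (eval_gen c) (eval_gen c') (evalE a) (evalE a') -ac -ac'.
have h : lev (ehead a) = (lev (ehead c)).+1 by rewrite ac tc.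
have h' : lev (ehead a') = (lev (ehead c')).+1 by rewrite ac' tc'.
by rewrite (eop_eop _ _ ta h) (eop_eop _ _ ta' h') tE hE uu' subrr.
Qed.

(** * Independence of normal words *)

Local Notation genv := (fun v u => gen (ed v u)).
Local Notation down v := (ed v (b (lev v).-1)).

Lemma downP (v : vert G) : (0 < lev v)%N ->
  etail (down v) = v /\ ehead (down v) = b (lev v).-1.
Proof.
move=> v0; apply: edP; rewrite level_b ?prednK //.
by rewrite (leq_trans (leq_pred _)) // leq_ord.
Qed.

Lemma yop_base (v : vert G) f w : is_base v -> yop v f w = 0.
Proof. by rewrite /yop => ->. Qed.

Lemma eval_down (v : vert G) f w : (0 < lev v)%N ->
  eval (gen (down v)) f w = xop (lev v) f w + yop v f w.
Proof.
move=> v0; have [dt dh] := downP v0.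
rewrite eval_gen dt dh /eop [X in _ - X]yop_base ?subr0 // base_b //.
by rewrite (leq_trans (leq_pred _)) // leq_ord.
Qed.

(** On words it may precede, a letter acts by prepending: for a nonbase [v], the two edges share the
    [xop] term, which cancels. *)
Lemma eval_letter (v : vert G) f w : (0 < lev v)%N -> adm v w ->
  eval (letter_of genv v) f w = f (v :: w).
Proof.
move=> v0 vw; rewrite /letter_of; case: ifP => bv.
  rewrite eval_down // yop_base // addr0 /xop.
  by move: (bv); rewrite /is_base => /eqP <-; rewrite vw.
have bE : eval (gen (ed (b (lev v)) (b (lev v).-1))) f w = xop (lev v) f w.
  have := @eval_down (b (lev v)) f w; rewrite level_bl => -> //.
  by rewrite yop_base ?base_bl // addr0.
by rewrite evalB eval_down // bE addrAC subrr add0r /yop bv vw.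
Qed.

Lemma eval_word w f :
  normalG w -> eval (word_of genv w) f [::] = f w.
Proof.
elim: w f => [|v w IH] f; first by rewrite /word_of big_nil eval1.
rewrite normal_cons => /and3P[v0 vw nw].
by rewrite /word_of big_cons evalM IH // eval_letter.
Qed.

Lemma homogeneousD i (x y : T) :
  homogeneous i x -> homogeneous i y -> homogeneous i (x + y).
Proof.
move=> hx hy w; rewrite mcoeffD; have [->|/hx //] := eqVneq x@_w 0.
by rewrite add0r => /hy.
Qed.

Lemma homogeneousN i (x : T) : homogeneous i x -> homogeneous i (- x).
Proof. by move=> hx w; rewrite mcoeffN oppr_eq0 => /hx. Qed.

Lemma homogeneousM i j (x y : T) :
  homogeneous i x -> homogeneous j y -> homogeneous (i + j) (x * y).
Proof.
move=> hx hy w; apply: contra_neq_eq => wij; rewrite mcoeffMl big1 // => k _.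
rewrite big1 // => l _; case: eqP => // kl.
have [->|/hx ki] := eqVneq x@_k 0; first by rewrite mul0r.
have [->|/hy lj] := eqVneq y@_l 0; first by rewrite mulr0.
by case/eqP: wij; rewrite -kl -ki -lj fdegM.
Qed.

Lemma homogeneous_word w : homogeneous (size w) (word_of genv w).
Proof.
have hgen e : homogeneous 1 (gen e).
  move=> k; rewrite mcoeffU1; case: (_ =P k) => [<- _|_]; last by rewrite eqxx.
  exact: fdegU.
elim: w => [|v w IH].
  move=> k; rewrite /word_of big_nil mcoeff1.
  case: (k =P _) => [->|_]; last by rewrite eqxx.
  by rewrite fdeg1.
rewrite /word_of big_cons; apply: (@homogeneousM 1) => //.
rewrite /letter_of; case: ifP => // _.
by apply: homogeneousD => //; apply: homogeneousN.
Qed.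

(** * Dimensions of the graded components *)

Local Notation A := (graph_alg F G).
Local Notation pi := (@graph_alg_pi F n G).
Local Notation E v u := (pi (gen (ed v u))).
Lemma parallel2_edges (v u u' z : vert G) :
  lev v = (lev u).+1 -> lev u' = lev u -> lev u = (lev z).+1 ->
  parallel2 (ed v u) (ed u z) (ed v u') (ed u' z).
Proof.
move=> vu uu' uz; have vu' : lev v = (lev u').+1 by rewrite uu'.
have [[t1 h1] [t2 h2]] := (edP vu, edP uz).
have [[t3 h3] [t4 h4]] := (edP vu', edP (etrans uu' uz)).
by split; rewrite ?t1 ?t2 ?t3 ?t4 ?h1 ?h2 ?h3 ?h4.
Qed.

Lemma edge_add (v u u' z : vert G) :
  lev v = (lev u).+1 -> lev u' = lev u -> lev u = (lev z).+1 ->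
  E v u + E u z = E v u' + E u' z.
Proof.
move=> vu uu' uz; rewrite -!raddfD; apply/graph_alg_eqP/graph_idealP.
by apply: relator_add; apply: parallel2_edges.
Qed.

Lemma edge_mul (v u u' z : vert G) :
  lev v = (lev u).+1 -> lev u' = lev u -> lev u = (lev z).+1 ->
  E v u * E u z = E v u' * E u' z.
Proof.
move=> vu uu' uz; rewrite -!rmorphM; apply/graph_alg_eqP/graph_idealP.
by apply: relator_mul; apply: parallel2_edges.
Qed.

Lemma pi_monomial (k : {fmonom edge G}) :
  pi << k >> = \prod_(a <- k) pi (gen a).
Proof.
case: k => t; rewrite /fmonom_val; elim: t => [|a t IH].
  by rewrite big_nil -(rmorph1 pi) -fmoneE.
rewrite big_cons -IH -rmorphM; congr (pi _).
by rewrite malgM_def fgmulUU mulr1 /mmul /= fmmulE fmuE.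
Qed.

Lemma normal_span_deg d a :
  @graph_alg_deg F n G d a -> normal_span (fun v u => E v u) d a.
Proof.
move=> [x hx ->]; rewrite (monalgE x) raddf_sum /=.
apply: normal_span_sum => k; rewrite -mcoeff_neq0 => /hx kd _.
have -> : << x@_k *g k >> = x@_k *: << k >> :> T.
  by apply/malgP => l; rewrite mcoeffZ !mcoeffU mulrnAr mulr1.
rewrite graph_alg_pi_scalable; apply: normal_spanZ.
rewrite -kd pi_monomial fdegE.
have -> : \prod_(a <- k) pi (gen a) = \prod_(a <- k) E (etail a) (ehead a).
  apply: eq_bigr => c _; congr (pi (gen _)).
  (* Uniqueness of edges identifies [c] with the chosen edge between its ends. *)
  have [c' [_ cU]] : exists! c', etail c' = etail c /\ ehead c' = ehead c.
    by apply: complG; rewrite levelE.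
  by rewrite -[LHS](cU c) //; apply/cU/edP; rewrite levelE.
by apply: normal_span_path; [exact: edge_add|exact: edge_mul].
Qed.

Lemma dim_graph_alg d : subdim (@graph_alg_deg F n G d) = size (nwords d).
Proof.
apply: dimP; exists (fun i => pi (word_of genv (nth [::] (nwords d) i))).
have nthP (i : 'I_(size (nwords d))) : nth [::] (nwords d) i \in nwords d.
  exact: mem_nth.
split=> [i|c c0 j|a].
- exists (word_of genv (nth [::] (nwords d) i)) => //.
  have := nthP i; rewrite mem_normal_words => /andP[/eqP wd _].
  by rewrite -[X in homogeneous X _]wd; apply: homogeneous_word.
- have : pi (\sum_i c i *: word_of genv (nth [::] (nwords d) i)) = pi 0.
    rewrite raddf_sum raddf0 -[RHS]c0.
    by apply: eq_bigr => i _; apply: graph_alg_pi_scalable.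
  move/graph_alg_eqP; rewrite subr0 => /eval_ideal.
  (* Evaluation of the indicator of the [j]-th normal word at the empty word extracts the
     coefficient [c j]. *)
  move=> /(_ (fun w => (w == nth [::] (nwords d) j)%:R) [::]).
  rewrite eval_mmap raddf_sum /= (bigD1 j) //= big1 => [|i ij].
    rewrite -eval_mmap evalZ eval_word; last first.
      by have := nthP j; rewrite mem_normal_words => /andP[].
    by rewrite eqxx mulr1 addr0.
  rewrite -eval_mmap evalZ eval_word; last first.
    by have := nthP i; rewrite mem_normal_words => /andP[].
  rewrite nth_uniq ?uniq_normal_words //.
  by move: ij; rewrite -val_eqE => /negPf->; rewrite mulr0.
- move/normal_span_deg => [c ->]; exists (fun i => c (nth [::] (nwords d) i)).
  rewrite (big_nth [::]) big_mkord; apply: eq_bigr => i _.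
  by rewrite -(rmorph_word pi).
Qed.

End CompleteGraph.

(** * Choice of base vertices and edges *)

Section LayerChoices.
Variables (n : nat) (m : nat -> nat) (G : layered_graph n).
Hypothesis m_gt0 : forall i, (i <= n)%N -> (0 < m i)%N.
Hypothesis complG : is_complete_layered_graph m G.

Lemma card_level i :
  (i <= n)%N -> #|[pred v : vert G | level v == i :> nat]| = m i.
Proof.
move=> i_n; rewrite -(inordK (i_n : i < n.+1)%N) -complG.2; apply: eq_card => v.
by rewrite !inE.
Qed.

Lemma base_exists :
  exists b : nat -> vert G, forall i, (i <= n)%N -> level (b i) = i :> nat.
Proof.
have levelP i : (i <= n)%N -> exists v : vert G, level v = i :> nat.
  move=> i_n; have := m_gt0 i_n; rewrite -(card_level i_n) => /card_gt0P[v].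
  by rewrite inE => /eqP vi; exists v.
(* A default vertex for the indices above [n]. *)
have [v0 _] := levelP 0%N (leq0n n).
suff /choice[b bP] : forall i, exists v : vert G,
    (i <= n)%N -> level v = i :> nat.
  by exists b.
move=> i; have [/levelP[v vi]|//] := leqP i n; first by exists v.
by exists v0.
Qed.

Lemma edge_exists : (0 < n)%N ->
  exists ed : vert G -> vert G -> edge G, forall v w,
    level v = (level w).+1 :> nat -> etail (ed v w) = v /\ ehead (ed v w) = w.
Proof.
move=> n0; have [b bP] := base_exists.
(* As [n] is positive some edge exists; it is the default for pairs not on consecutive levels. *)
have [e0 _] : exists! e, etail e = b 1%N /\ ehead e = b 0%N.
  by apply: complG.1; rewrite !bP.
suff /choice[ed edP] : forall p : vert G * vert G, exists e : edge G,
    level p.1 = (level p.2).+1 :> nat -> etail e = p.1 /\ ehead e = p.2.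
  by exists (fun v w => ed (v, w)) => v w; apply: (edP (v, w)).
move=> p.
have [/complG.1[e [eP _]]|np] := pselect (level p.1 = (level p.2).+1 :> nat).
  by exists e.
by exists e0.
Qed.

Variable b : nat -> vert G.
Hypothesis level_b : forall i, (i <= n)%N -> level (b i) = i :> nat.

Lemma card_nonbase i : (i <= n)%N ->
  #|[pred v : vert G | (level v == i :> nat) && ~~ is_base b v]|.+1 = m i.
Proof.
move=> i_n; rewrite -card_level // [in RHS](cardD1 (b i)) inE level_b // eqxx.
rewrite add1n; congr _.+1; apply: eq_card => v; rewrite !inE andbC.
by have [vi|] := eqVneq (nat_of_ord (level v)) i; rewrite ?andbF // /is_base vi.
Qed.

Lemma level0_unique : m 0%N = 1%N ->
  forall v : vert G, level v = 0%N :> nat -> v = b 0.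
Proof.
move=> m0 v v0; have := card_level (leq0n n); rewrite m0 => /mem_card1[u uP].
have /eqP-> : v == u by rewrite -[_ == _]uP inE v0.
by apply/esym/eqP; rewrite -[_ == _]uP inE level_b.
Qed.

End LayerChoices.

Theorem theorem5 (F : fieldType) (n : nat) (m : nat -> nat)
    (G : layered_graph n) :
  (1 <= n)%N ->
  (forall i : nat, (1 <= i <= n)%N -> (0 < m i)%N) ->
  m 0%N = 1%N ->
  is_complete_layered_graph m G ->
  ps_div (ps_of_poly (1 - 'X)) (hilbert_series F G)
  =1 ps_of_poly
       (1 - \sum_(0 <= k < n.+1) \sum_(k <= a < n.+1)
              ((-1) ^+ k * chain_term m a k) *: 'X^(k.+1)).
Proof.
move=> n0 m_gt0 m0 complG.
have m_pos i : (i <= n)%N -> (0 < m i)%N.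
  by case: i => [|i] i_n; rewrite ?m0 // m_gt0.
have [b level_b] := base_exists m_pos complG.
have [ed edP] := edge_exists m_pos complG n0.
have level0 := level0_unique complG level_b m0.
have hilbE : hilbert_series F G = fun d => (size
    (normal_words (fun v : vert G => level v : nat) (is_base b) d))%:R.
  apply/funext => d; congr (_%:R).
  exact: (dim_graph_alg F complG.1 level_b level0 edP).
(* The cofactor of [1 - 'X] is the inverse of the Hilbert series, whose constant term 1 counts the
   empty word. *)
rewrite -chain_sum // hilbE; apply: ps_div_poly => //.
apply: normal_words_series => // [v|i|i].
- exact: leq_ord.
- exact: card_level.
- exact: card_nonbase.
Qed.
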